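(* Let $\chi^2_{m_1},\chi^2_{m_2},V$ be independent random variables, where $\chi^2_{m_i}$ is chi-square with $m_i$ degrees of freedom and $V$ is chi-square with $\nu$ degrees of freedom ($m_1,m_2,\nu$ positive integers), let $\alpha_1>\alpha_2>0$, put $|m|=m_1+m_2$, and let $$W=\frac{(\alpha_1\chi^2_{m_1}+\alpha_2\chi^2_{m_2})/|m|}{V/\nu}.$$ Put $a=\nu\alpha_2/|m|$, $t(w)=w/(a+w)$ and $u_1=1-\alpha_2/\alpha_1$. Then the probability density function $h_W$ of $W$ is given, for $w>0$, by $$h_W(w)=AB_0B_1(w)\sum_{j=0}^\infty\frac{\left(\frac{\nu+m_1+m_2}{2}\right)_j\left(\frac{m_1}{2}\right)_j}{j!\left(\frac{m_1+m_2}{2}\right)_j}(u_1t(w))^j=AB_0B_1(w)\;{}_2F_1\left(\frac{\nu+m_1+m_2}{2},\frac{m_1}{2};\frac{m_1+m_2}{2};\left(1-\frac{\alpha_2}{\alpha_1}\right)\frac{w}{a+w}\right).$$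
   Context: Here $(b)_j=b(b+1)\cdots(b+j-1)$ is the Pochhammer symbol ($(b)_0=1$), ${}_2F_1(p,q;s;x)=\sum_{j\ge0}\frac{(p)_j(q)_j}{(s)_j\,j!}x^j$ is the Gauss hypergeometric series, and $$A=\left(\frac{\alpha_1}{\alpha_2}\right)^{-m_1/2},\qquad B_0=a^{\nu/2}\,\frac{\Gamma\left(\frac{\nu+|m|}{2}\right)}{\Gamma\left(\frac{|m|}{2}\right)\Gamma\left(\frac{\nu}{2}\right)},\qquad B_1(w)=\frac{w^{(|m|-2)/2}}{(a+w)^{(\nu+|m|)/2}}.$$ *)

(* Defs.v *)
From mathcomp Require Export all_boot all_order all_algebra.
From mathcomp Require Export all_classical all_reals all_analysis.
Export Order.TTheory GRing.Theory Num.Theory.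
Export numFieldNormedType.Exports.

Set Implicit Arguments.
Unset Strict Implicit.
Unset Printing Implicit Defensive.

Local Open Scope classical_set_scope.
Local Open Scope ring_scope.

Definition pochhammer (R : realType) (b : R) (j : nat) : R :=
  \prod_(0 <= i < j) (b + i%:R).

(* Euler's integral; meaningful for [0 < s], where the integrand is
   integrable. *)
Definition Gamma (R : realType) (s : R) : R :=
  (\int[lebesgue_measure]_(x in `]0, +oo[) (x `^ (s - 1) * expR (- x)))%R.

(* Meaningful when the series converges; [limn] is arbitrary otherwise. *)
Definition hyp2F1 (R : realType) (p q s x : R) : R :=
  limn (series (fun j : nat =>
    pochhammer p j * pochhammer q j / (pochhammer s j * j`!%:R) * x ^+ j)).

(* [X] is a random variable whose law has density [f] with respect to
   Lebesgue measure. *)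
Definition has_pdf (d : measure_display) (T : measurableType d) (R : realType)
    (P : probability T R) (X : T -> R) (f : R -> R) : Prop :=
  [/\ measurable_fun [set: T] X,
      measurable_fun [set: R] f,
      (forall x, 0 <= f x) &
      forall A : set R, measurable A ->
        P (X @^-1` A) = (\int[lebesgue_measure]_(x in A) (f x)%:E)%E].

Definition chi2_pdf (R : realType) (k : nat) (x : R) : R :=
  if 0 < x then
    x `^ (k%:R / 2 - 1) * expR (- x / 2) / (2 `^ (k%:R / 2) * Gamma (k%:R / 2))
  else 0.

Definition chi_square (d : measure_display) (T : measurableType d)
    (R : realType) (P : probability T R) (k : nat) (X : T -> R) : Prop :=
  has_pdf P X (chi2_pdf k).

(* Mutual independence; the product rule for pairs is the case where one of
   the sets is [setT]. *)
Definition independent3 (d : measure_display) (T : measurableType d)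
    (R : realType) (P : probability T R) (X Y Z : T -> R) : Prop :=
  forall A B C : set R, measurable A -> measurable B -> measurable C ->
    P (X @^-1` A `&` Y @^-1` B `&` Z @^-1` C) =
      (P (X @^-1` A) * P (Y @^-1` B) * P (Z @^-1` C))%E.

(* Main.v *)
From HB Require Import structures.
Require Import Defs.
From mathcomp Require Import ring measurable_realfun.

(** The ratio is [W = (a * r * x + a * y) / v], where [r = alpha1 / alpha2 > 1]
    and [(x, y, v)] is the value of [(X1, X2, V)], whose joint density is the
    product of three gamma kernels (lemma [triple_density]). In the triple
    integral giving the probability that [W] lies in a set, put [y = r * x * z];
    then [W = a * r * x * (1 + z) / v], and taking [w = W] in place of [x] is
    another dilation. Tonelli's theorem brings [w] to the outside, and the
    density at [w] is what remains after integrating over [z] and [v].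

    In these variables the exponent splits into [- (a + w) / (2 * a) * v] and
    the positive term [kappa * w * v / (1 + z)] with
    [kappa = (1 - alpha2 / alpha1) / (2 * a)]. Expanding the exponential of the
    latter in a power series separates [z] from [v] in each term: the
    [z]-integral is a beta integral (lemma [integral_z_kernel]) and the
    [v]-integral is a gamma integral (lemma [integral_v_kernel]). Every
    integrand and every term is nonnegative, so all exchanges of sums and
    integrals hold in the extended reals without any integrability condition.
    This is lemma [integral_ratio]. The functional equation of the gamma
    function turns the resulting quotients of gamma values into Pochhammer
    symbols, and collecting powers gives the stated prefactor and the terms of
    the hypergeometric series (lemma [ratio_term_hyp]).

    The series converges because its argument
    [(1 - alpha2 / alpha1) * (w / (a + w))] lies between 0 and 1 and its terms
    are dominated by those of a negative binomial series (lemma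
    [hyp_term_summable]).

    The gamma function is developed from Euler's integral. The beta integral is
    used in its beta-prime form, over the whole half-line, which is what the
    substitution [y = r * x * z] produces; its case of second parameter 1 yields
    the functional equation, and finiteness follows from that. *)

Set Implicit Arguments.
Unset Strict Implicit.
Unset Printing Implicit Defensive.
Local Open Scope classical_set_scope.
Local Open Scope ring_scope.

(** * Scaling and Tonelli on the positive half-line *)

Section scaling.
Context {R : realType}.
Local Notation mu := (@lebesgue_measure R).
Local Notation D := (`]0%R, +oo[%classic : set R).

(** The image of Lebesgue measure under multiplication by [c], rescaled by [c],
    gives every interval its length, so it is Lebesgue measure. Dilations are
    the only changes of variables used below: each substitution has an
    integration variable multiplied by a factor in which that variable does
    not occur. *)
Lemma integral_positive_scale (c : R) (f : R -> \bar R) : 0 < c ->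
  measurable_fun D f -> (forall x, D x -> (0 <= f x)%E) ->
  (\int[mu]_(x in D) f x = \int[mu]_(x in D) (c%:E * f (c * x)%R))%E.
Proof.
move=> c0 mf f0.
(* [measurableTypeR R] and [R] carry convertible sigma-algebras under different
   displays; Lebesgue measure lives on the former. *)
have mc : measurable_fun [set: measurableTypeR R]
    ( *%R c : measurableTypeR R -> measurableTypeR R) by exact: mulrl_measurable.
pose cn := NngNum (ltW c0).
pose pushc : {measure set (measurableTypeR R) -> \bar R} :=
  measure_function_pushforward__canonical__measure_function_Measure mu mc.
pose nu : {measure set (measurableTypeR R) -> \bar R} := mscale cn pushc.
have muE (A : set R) : measurable A -> mu A = nu A.
  apply: (@lebesgue_measure_unique _ nu) => //= _ [[a b]] _ <-.
  rewrite /nu /mscale/= /pushforward.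
  have -> : *%R c @^-1` `]a, b]%classic = `](a / c), (b / c)]%classic.
    by apply/seteqP; split=> x /=; rewrite !in_itv/= ltr_pdivrMr// ler_pdivlMr// mulrC.
  rewrite !lebesgue_measure_itv/= !lte_fin ltr_pM2r ?invr_gt0//.
  case: ifPn => _; last by rewrite mule0.
  rewrite -!EFinB -EFinM; congr EFin; rewrite /=; field; exact: lt0r_neq0.
have DE : *%R c @^-1` D = D.
  by apply/seteqP; split=> x /=; rewrite !in_itv/= !andbT pmulr_rgt0.
transitivity (\int[nu]_(x in D) f x)%E.
  by apply: eq_measure_integral => A mA _; exact: muE.
rewrite ge0_integral_mscale//=.
rewrite ge0_integral_pushforward//; last first.
  by move=> y; rewrite inE; exact: f0.
have DcD x : D x -> D (c * x) by rewrite /= !in_itv/= !andbT pmulr_rgt0.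
have mfc : measurable_fun D (fun x => f (c * x)).
  apply: (measurable_comp (F := D) _ _ mf) => //.
  by move=> _ [x Dx <-]; exact: DcD.
rewrite DE ge0_integralZl//.
- by move=> x /DcD; exact: f0.
- by rewrite lee_fin ltW.
Qed.

End scaling.

Ltac prove_measurable := repeat first
  [ exact: measurable_cst | exact: measurable_id
  | exact: measurable_fst | exact: measurable_snd
  | apply: measurable_funM | apply: measurable_funD
  | apply: (measurableT_comp (measurable_powR _))
  | apply: (measurableT_comp (@measurable_expR _))
  | apply: (measurableT_comp (@oppr_measurable _ _))
  | apply: measurable_funX ].

Section tonelli_and_gamma_integral.
Context {R : realType}.
Local Notation mu := (@lebesgue_measure R).
Local Notation D := (`]0%R, +oo[%classic : set R).

(** Measurability is only required on the positive quadrant because the series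
    to which this is applied have terms that change sign outside it. *)
Lemma tonelli_positive (f : R -> R -> \bar R) :
  measurable_fun (D `*` D) (fun z : R * R => f z.1 z.2) ->
  (forall x y, D x -> D y -> (0 <= f x y)%E) ->
  (\int[mu]_(x in D) \int[mu]_(y in D) f x y =
   \int[mu]_(y in D) \int[mu]_(x in D) f x y)%E.
Proof.
move=> mf f0.
pose g := ((fun z : R * R => f z.1 z.2) \_ (D `*` D)).
have gE x y : g (x, y) = (if (x \in D) && (y \in D) then f x y else 0%E).
  by rewrite /g patchE in_setX.
have mg : measurable_fun [set: R * R] g.
  by apply/measurable_restrict; [exact: measurableX| |rewrite setTI].
have g0 z : (0 <= g z)%E.
  case: z => x y; rewrite gE; case: ifPn => // /andP[].
  by rewrite !inE; exact: f0.
transitivity (\int[mu]_x \int[mu]_y g (x, y))%E.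
  rewrite integral_mkcond; apply: eq_integral => x _.
  rewrite patchE; case: ifPn => xD.
    rewrite integral_mkcond; apply: eq_integral => y _.
    by rewrite gE patchE xD.
  by rewrite integral0_eq// => y _; rewrite gE (negbTE xD).
rewrite (@fubini_tonelli _ _ _ _ _ mu mu g mg g0).
rewrite [RHS]integral_mkcond; apply: eq_integral => y _.
rewrite patchE; case: ifPn => yD.
  rewrite [RHS]integral_mkcond; apply: eq_integral => x _.
  by rewrite gE patchE yD andbT.
by rewrite integral0_eq// => x _; rewrite gE (negbTE yD) andbF.
Qed.

Lemma expRE_nneseries (x : R) : 0 <= x ->
  (expR x)%:E = (\sum_(j <oo) (x ^+ j / j`!%:R)%:E)%E.
Proof.
move=> x0.
have h : cvgn (series (exp_coeff x)) by exact: is_cvg_series_exp_coeff.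
rewrite /expR -EFin_lim//; congr (limn _).
by apply/funext => n /=; rewrite /series/= sumEFin.
Qed.

(** Keeping the Euler integral in the extended reals lets the beta identity and
    the functional equation be derived by Tonelli before finiteness is known. *)
Definition eGamma (s : R) : \bar R :=
  (\int[mu]_(x in D) (x `^ (s - 1) * expR (- x))%:E)%E.

Lemma integral_gamma (s c : R) : 0 < c ->
  (\int[mu]_(x in D) (x `^ (s - 1) * expR (- (c * x)))%:E
   = (c `^ (- s))%:E * eGamma s)%E.
Proof.
move=> c0; rewrite /eGamma [X in (_ * X)%E](@integral_positive_scale _ c _ c0); last 2 first.
- by apply/measurable_EFinP; prove_measurable.
- by move=> x _; rewrite lee_fin mulr_ge0// ?powR_ge0// expR_ge0.
rewrite -ge0_integralZl//; last 3 first.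
- by apply/measurable_EFinP; prove_measurable.
- by move=> x _; rewrite -EFinM lee_fin !mulr_ge0 ?powR_ge0 ?expR_ge0 ?ltW.
- by rewrite lee_fin powR_ge0.
apply: eq_integral => x; rewrite inE/= in_itv/= andbT => x0.
rewrite -!EFinM; congr EFin.
rewrite powRM ?ltW//.
have -> : c `^ (- s) = c ^-1 * c `^ (- (s - 1)).
  rewrite -powR_inv1 ?ltW// -powRD; last by rewrite (gt_eqF c0) implybT.
  by congr (_ `^ _); ring.
by rewrite powRN; field; rewrite !gt_eqF// powR_gt0.
Qed.

End tonelli_and_gamma_integral.

(** * The gamma and beta integrals *)

Section beta_prime.
Context {R : realType}.
Local Notation mu := (@lebesgue_measure R).
Local Notation D := (`]0%R, +oo[%classic : set R).

Lemma eGamma_ge0 (s : R) : (0 <= eGamma s)%E.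
Proof.
by apply: integral_ge0 => x _; rewrite lee_fin mulr_ge0 ?powR_ge0 ?expR_ge0.
Qed.

(** Write the product as a double integral in [x] and [y], put [y = x * z], and
    integrate [x] first: the exponential becomes [expR (- ((1 + z) * x))], and
    scaling [x] by [1 + z] produces [eGamma (a + b)]. The integral left over is
    the beta function in its beta-prime form. *)
Lemma eGamma_beta (a b : R) :
  (eGamma a * eGamma b = eGamma (a + b) *
    \int[mu]_(z in D) (z `^ (b - 1) * (1 + z) `^ (- (a + b)))%:E)%E.
Proof.
transitivity (\int[mu]_(x in D) \int[mu]_(z in D)
    (x `^ (a + b - 1) * expR (- ((1 + z) * x)) * z `^ (b - 1))%:E)%E.
  rewrite {1}/eGamma -ge0_integralZr//; last 3 first.
  - by apply/measurable_EFinP; prove_measurable.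
  - by move=> x _; rewrite lee_fin mulr_ge0 ?powR_ge0 ?expR_ge0.
  - exact: eGamma_ge0.
  apply: eq_integral => x; rewrite inE/= in_itv/= andbT => x0.
  rewrite /eGamma (@integral_positive_scale _ x _ x0); last 2 first.
  - by apply/measurable_EFinP; prove_measurable.
  - by move=> y _; rewrite lee_fin mulr_ge0 ?powR_ge0 ?expR_ge0.
  rewrite -ge0_integralZl//; last 3 first.
  - by apply/measurable_EFinP; prove_measurable.
  - by move=> y _; rewrite -EFinM lee_fin !mulr_ge0 ?powR_ge0 ?expR_ge0 ?ltW.
  - by rewrite lee_fin mulr_ge0 ?powR_ge0 ?expR_ge0.
  apply: eq_integral => z; rewrite inE/= in_itv/= andbT => z0.
  rewrite -!EFinM; congr EFin.
  rewrite powRM ?ltW// (_ : - ((1 + z) * x) = - x + - (x * z)); last by ring.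
  rewrite expRD (_ : a + b - 1 = (a - 1) + (1 + (b - 1))); last by ring.
  rewrite !(@powRD _ x) ?(gt_eqF x0) ?implybT// powRr1 ?ltW//.
  by ring.
rewrite tonelli_positive; last 2 first.
- by apply: measurable_funTS; apply/measurable_EFinP; prove_measurable.
- by move=> x z _ _; rewrite lee_fin !mulr_ge0 ?powR_ge0 ?expR_ge0.
rewrite -ge0_integralZl//; last 3 first.
- by apply/measurable_EFinP; prove_measurable.
- by move=> z _; rewrite lee_fin mulr_ge0 ?powR_ge0 ?expR_ge0.
- exact: eGamma_ge0.
apply: eq_integral => z; rewrite inE/= in_itv/= andbT => z0.
have z1 : 0 < 1 + z by rewrite ltr_wpDl.
under eq_integral do rewrite EFinM.
rewrite ge0_integralZr//; last 3 first.
- by apply/measurable_EFinP; prove_measurable.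
- by move=> x _; rewrite lee_fin mulr_ge0 ?powR_ge0 ?expR_ge0.
- by rewrite lee_fin powR_ge0.
by rewrite integral_gamma// muleAC muleC -EFinM [in RHS]mulrC.
Qed.

Lemma integral_positive_FTC (f F : R -> R) (l : R) :
  (forall x : R, 0 <= x -> 0 <= f x) ->
  (forall x : R, 0 <= x -> {for x, continuous f}) ->
  F x @[x --> +oo] --> l ->
  (forall x : R, 0 <= x -> derivable F x 1 /\ 'D_1 F x = f x) ->
  (\int[mu]_(x in D) (f x)%:E = (l - F 0)%:E)%E.
Proof.
move=> f0 cf Fl dF.
have mf : measurable_fun D f.
  apply: open_continuous_measurable_fun => //.
  by move=> x; rewrite inE/= in_itv/= andbT => /ltW; exact: cf.
have cF x : 0 <= x -> {for x, continuous F}.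
  move=> x0; apply: differentiable_continuous; apply/derivable1_diffP.
  by have [] := dF x x0.
rewrite integral_itv_obnd_cbnd; last exact/measurable_EFinP.
rewrite (@ge0_continuous_FTC2y _ f F _ l)//.
- apply/continuous_within_itvcyP; split.
    by move=> x; rewrite in_itv/= andbT => /ltW; exact: cf.
  by apply: cvg_at_right_filter; exact: cf.
- by move=> x /ltW/dF[].
- by apply: cvg_at_right_filter; exact: cF.
- by move=> x; rewrite in_itv/= andbT => /ltW/dF[_ +]; rewrite derive1E.
Qed.

Lemma eGamma1 : eGamma (1 : R) = 1%E.
Proof.
transitivity (\int[mu]_(x in D) (expR (- x))%:E)%E.
  by apply: eq_integral => x _; rewrite subrr powRr0 mul1r.
rewrite (@integral_positive_FTC _ (fun x => - expR (- x)) 0)//.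
- by rewrite oppr0 expR0 opprK add0r.
- move=> x _.
  apply: continuous_comp; first exact: opp_continuous.
  exact: continuous_expR.
- by rewrite -[X in _ --> X]oppr0; apply: cvgN; exact: cvgr_expR.
- move=> x _.
  have [] // : is_derive x 1 (fun x : R => - expR (- x)) (expR (- x)).
  by apply: is_derive_eq; rewrite mulrN1 opprK.
Qed.

Lemma powRN_cvg0 (s : R) : 0 < s -> (1 + x) `^ (- s) @[x --> +oo] --> 0.
Proof.
move=> s0.
apply/cvgr0Pnorm_lt => e e0.
near=> x.
(* [e `^ (- s^-1)] is the point where the decreasing power takes the value [e]. *)
have Mx : e `^ (- s^-1) < 1 + x.
  by rewrite -ltrBlDl; near: x; apply: nbhs_pinfty_gt; exact: num_real.
have x1 : 0 < 1 + x by rewrite (lt_trans _ Mx)// powR_gt0.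
rewrite ger0_norm ?powR_ge0// powRN.
have := gt0_ltr_powR s0 (powR_ge0 e (- s^-1)) (ltW x1) Mx.
rewrite -powRrM mulNr mulVf ?gt_eqF// powR_inv1 ?ltW//.
by rewrite -[X in _ -> _ < X]invrK ltf_pV2// ?posrE ?powR_gt0 ?invr_gt0.
Unshelve. all: by end_near. Qed.

(** The beta-prime integral with second parameter 1 has an elementary
    primitive which, unlike a power of [x], is smooth at 0. *)
Lemma integral_beta1 (s : R) : 0 < s ->
   (\int[mu]_(z in D) (z `^ (1 - 1) * (1 + z) `^ (- (s + 1)))%:E)%E = (s^-1)%:E.
Proof.
move=> s0.
transitivity (\int[mu]_(z in D) ((1 + z) `^ (- s - 1))%:E)%E.
  by apply: eq_integral => z _; rewrite subrr powRr0 mul1r opprD.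
have dF (p x : R) : 0 <= x ->
    is_derive x 1 (fun z => (1 + z) `^ p) (p * (1 + x) `^ (p - 1)).
  move=> x0; have x1 : 0 < 1 + x by rewrite ltr_wpDr.
  have d1 := is_derive1_powR p x1.
  have := @is_derive1_comp _ (@powR R ^~ p) (fun z => 1 + z) x _ 1 d1.
  rewrite mulr1; apply.
  by have := is_deriveD (is_derive_cst (1 : R) x 1) (is_derive_id x (1 : R)); rewrite add0r.
rewrite (@integral_positive_FTC _ (fun z => - s^-1 * (1 + z) `^ (- s)) 0)//.
- by rewrite addr0 powR1 mulr1 sub0r opprK.
- by move=> x _; exact: powR_ge0.
- move=> x x0.
  apply: differentiable_continuous; apply/derivable1_diffP.
  by have [] := dF (- s - 1) x x0.
- rewrite -[X in _ --> X](mulr0 (- s^-1)); apply: cvgMr; exact: powRN_cvg0.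
- move=> x x0; have := dF (- s) x x0 => d1.
  have [] // : is_derive x 1 (fun z => - s^-1 * (1 + z) `^ (- s)) ((1 + x) `^ (- s - 1)).
  by apply: is_derive_eq; rewrite /GRing.scale/=; field; rewrite gt_eqF.
Qed.

(** The case [b = 1] of the beta identity. This replaces an integration by
    parts, whose boundary behaviour at 0 is delicate for [s < 1]. *)
Lemma eGammaS (s : R) : 0 < s -> (eGamma (s + 1) = s%:E * eGamma s)%E.
Proof.
move=> s0; have := eGamma_beta s 1.
rewrite eGamma1 mule1 => ->; rewrite integral_beta1//.
by rewrite muleCA -EFinM divff ?gt_eqF// mule1.
Qed.

End beta_prime.

Section gamma_function.
Context {R : realType}.
Local Notation mu := (@lebesgue_measure R).
Local Notation D := (`]0%R, +oo[%classic : set R).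
Implicit Types (s a b x : R).

(** For [0 < t <= 1], [x `^ t <= 1 + x] bounds [eGamma (t + 1)] by
    [eGamma 1 + eGamma 2 = 2]; the functional equation then gives finiteness at
    [t], and inductively at all positive arguments. *)
Lemma eGamma_lt_pinfty s : 0 < s -> (eGamma s < +oo)%E.
Proof.
have small (t : R) : 0 < t -> t <= 1 -> (eGamma t < +oo)%E.
  move=> t0 t1.
  have : (eGamma (t + 1) < +oo)%E.
    suff le2 : (eGamma (t + 1) <= eGamma (1%R : R) + eGamma (1 + 1)%R)%E.
      by apply: (le_lt_trans le2); rewrite eGammaS// eGamma1 mule1 -EFinD ltry.
    rewrite /eGamma -ge0_integralD//; last 4 first.
    - by move=> x _; rewrite lee_fin mulr_ge0 ?powR_ge0 ?expR_ge0.
    - by apply/measurable_EFinP; prove_measurable.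
    - by move=> x _; rewrite lee_fin mulr_ge0 ?powR_ge0 ?expR_ge0.
    - by apply/measurable_EFinP; prove_measurable.
    apply: ge0_le_integral => //.
    - by move=> x _; rewrite lee_fin mulr_ge0 ?powR_ge0 ?expR_ge0.
    - by apply/measurable_EFinP; prove_measurable.
    - suff : measurable_fun D (EFin \o (fun x : R =>
          x `^ (1 - 1) * expR (- x) + x `^ (1 + 1 - 1) * expR (- x))) by [].
      by apply/measurable_EFinP; prove_measurable.
    move=> x; rewrite /= in_itv/= andbT => x0.
    rewrite -EFinD lee_fin -mulrDl ler_pM2r ?expR_gt0// subrr !addrK powRr0.
    rewrite (powRr1 (ltW x0)); have [x1|x1] := leP x 1.
      rewrite -[leLHS]addr0 lerD ?(ltW x0)//.
      have := @ger_powR R x; rewrite x0 x1 => /(_ isT _ _ (ltW t0)).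
      by rewrite powRr0.
    rewrite -[leLHS]add0r lerD//.
    by have := ler_powR (ltW x1) t1; rewrite (powRr1 (ltW x0)).
  rewrite eGammaS//; case: (eGamma t) => [r| |]; rewrite ?ltry ?ltNyr//.
  by rewrite gt0_muley// lte_fin.
move=> s0.
have [n] : exists n : nat, s <= n.+1%:R.
  exists (Num.truncn s); exact/ltW/truncnS_gt.
elim: n s s0 => [|n IH] s s0 sn; first exact: small.
have [s1|s1] := leP s 1; first exact: small.
(* Step down with the functional equation until the argument is at most 1. *)
rewrite -(subrK 1 s) eGammaS ?subr_gt0// lte_mul_pinfty ?lee_fin ?subr_ge0 ?(ltW s1)//.
by apply: IH; rewrite ?subr_gt0// lerBlDr natr1.
Qed.

(** The integrand is bounded below by a positive constant on the interval
    from 1 to 2. *)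
Lemma eGamma_gt0 s : (0 < eGamma s)%E.
Proof.
pose m := Num.min 1 (2 `^ (s - 1)) * expR (- 2).
have m0 : 0 < m by rewrite mulr_gt0 ?expR_gt0// lt_min ltr01 powR_gt0.
apply: (@lt_le_trans _ _ (\int[mu]_(x in `]1%R, 2%R]) m%:E)%E).
  rewrite integral_cst//= lebesgue_measure_itv/= lte_fin ltr1n.
  by rewrite -EFinB -EFinM lte_fin mulr_gt0// subr_gt0 ltr1n.
apply: (@le_trans _ _ (\int[mu]_(x in `]1%R, 2%R]) (x `^ (s - 1) * expR (- x))%:E)%E).
  apply: ge0_le_integral => //.
  - by move=> x _; rewrite lee_fin ltW.
  - by apply: measurable_funTS; apply/measurable_EFinP; prove_measurable.
  move=> x; rewrite /= in_itv/= => /andP[x1 x2].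
  rewrite lee_fin ler_pM ?expR_ge0//.
  - have [s1|s1] := leP 1 s.
      rewrite ge_min; apply/orP; left.
      by have := ler_powR (ltW x1) (_ : 0 <= s - 1); rewrite powRr0; apply; rewrite subr_ge0.
    rewrite ge_min; apply/orP; right.
    rewrite -(opprK (s - 1)) !(powRN _ (- _)) lef_pV2 ?posrE ?powR_gt0//; last exact: lt_trans x1.
    apply: ge0_ler_powR => //; rewrite ?nnegrE; first by rewrite oppr_ge0 subr_le0 ltW.
    - by rewrite ltW// (lt_trans _ x1).
    - by rewrite ler0n.
  by rewrite ler_expR lerN2.
apply: ge0_subset_integral => //.
- by apply/measurable_EFinP; prove_measurable.
- by move=> x _; rewrite lee_fin mulr_ge0 ?powR_ge0 ?expR_ge0.
- by move=> x /=; rewrite !in_itv/= andbT => /andP[x1 _]; exact: lt_trans x1.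
Qed.

Lemma GammaE s : 0 < s -> (Gamma s)%:E = eGamma s.
Proof.
move=> s0; rewrite /Gamma /Rintegral fineK// ge0_fin_numE ?eGamma_ge0//.
exact: eGamma_lt_pinfty.
Qed.

Lemma Gamma_gt0 s : 0 < s -> 0 < Gamma s.
Proof. by move=> s0; rewrite -lte_fin GammaE// eGamma_gt0. Qed.

Lemma GammaS s : 0 < s -> Gamma (s + 1) = s * Gamma s.
Proof.
move=> s0; apply: EFin_inj.
by rewrite EFinM !GammaE ?addr_gt0// eGammaS.
Qed.

Lemma pochhammerS b j : pochhammer b j.+1 = pochhammer b j * (b + j%:R).
Proof. by rewrite /pochhammer big_nat_recr. Qed.

Lemma pochhammer_gt0 b j : 0 < b -> 0 < pochhammer b j.
Proof.
move=> b0; elim: j => [|j IH]; first by rewrite /pochhammer big_geq.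
by rewrite pochhammerS mulr_gt0// ltr_wpDr.
Qed.

Lemma Gamma_addn s j : 0 < s -> Gamma (s + j%:R) = pochhammer s j * Gamma s.
Proof.
move=> s0; elim: j => [|j IH].
  by rewrite /pochhammer big_geq// addr0 mul1r.
have sj : 0 < s + j%:R by rewrite ltr_wpDr.
rewrite -natr1 addrA (GammaS sj) IH pochhammerS mulrCA mulrA.
by congr (_ * _).
Qed.

Lemma integral_beta a b : 0 < a -> 0 < b ->
  (\int[mu]_(z in D) (z `^ (b - 1) * (1 + z) `^ (- (a + b)))%:E)%E =
  (Gamma a * Gamma b / Gamma (a + b))%:E.
Proof.
move=> a0 b0.
have ab0 : 0 < a + b by rewrite addr_gt0.
rewrite !EFinM !GammaE// eGamma_beta -GammaE//.
by rewrite muleAC -EFinM divff ?mul1e// gt_eqF// Gamma_gt0.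
Qed.

End gamma_function.

(** * The joint law of three independent variables with densities *)

Section density_measure.
Context (d : measure_display) (T : measurableType d) (R : realType).
Variables (m : {measure set T -> \bar R}) (F : T -> \bar R).
Hypotheses (mF : measurable_fun [set: T] F) (F0 : forall x, (0 <= F x)%E).

Let dens (A : set T) : \bar R := (\int[m]_(x in A) F x)%E.

Let dens0 : dens set0 = 0%E.
Proof. by rewrite /dens integral_set0. Qed.

Let dens_ge0 A : (0 <= dens A)%E.
Proof. by apply: integral_ge0. Qed.

Let dens_sigma_additive : semi_sigma_additive dens.
Proof.
move=> /= G mG tG mUG; rewrite /dens; apply: cvg_toP.
  apply: ereal_nondecreasing_is_cvgn => n n' nn'.
  by apply: lee_sum_nneg_natr => // k _ _; exact: integral_ge0.
by rewrite ge0_integral_bigcup//=; exact: measurable_funTS.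
Qed.

HB.instance Definition _ := isMeasure.Build _ _ _ dens
  dens0 dens_ge0 dens_sigma_additive.

(** An existential form suffices: only the values of the measure are used. *)
Lemma exists_density_measure :
  exists mF : {measure set T -> \bar R}, forall A, mF A = (\int[m]_(x in A) F x)%E.
Proof. by exists dens. Qed.

End density_measure.

Section measures_on_products.
Context (d1 d2 : measure_display) (T1 : measurableType d1) (T2 : measurableType d2).
Context (R : realType).
Variables (m1 m2 : {measure set (T1 * T2) -> \bar R}).

Lemma measure_eq_on_rectangles : (m1 setT < +oo)%E ->
  (forall A B, measurable A -> measurable B -> m1 (A `*` B) = m2 (A `*` B)) ->
  forall X, measurable X -> m1 X = m2 X.
Proof.
move=> m1oo m12 X mX.
pose C : set (set (T1 * T2)) := [set A `*` B | A in measurable & B in measurable].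
apply: (measure_unique C (fun=> setT)) mX => //.
- exact: measurable_prod_measurableType.
- move=> _ _ [A1 mA1 [B1 mB1 <-]] [A2 mA2 [B2 mB2 <-]].
  by rewrite -setXI; exists (A1 `&` A2); [exact: measurableI|
    exists (B1 `&` B2) => //; exact: measurableI].
- by move=> _; exists setT => //; exists setT => //; rewrite setXTT.
- by rewrite bigcup_const.
- by move=> _ [A mA [B mB <-]]; exact: m12.
Qed.

End measures_on_products.

Section joint_law.
Context (d : measure_display) (T : measurableType d) (R : realType).
Variable P : probability T R.
Local Notation mu := (@lebesgue_measure R).

(** Both sides are finite measures in [S]: the law of [(X, U)], and the measure
    with density [f] with respect to the product of Lebesgue measure and the
    law of [U]. They agree on rectangles by independence. Only [X] needs a
    density, so the lemma can be applied twice, first with [U] a pair. *)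
Lemma pair_density (d2 : measure_display) (T2 : measurableType d2)
    (X : T -> R) (U : T -> T2) (f : R -> R) (S : set (R * T2)) :
  has_pdf P X f -> measurable_fun [set: T] U ->
  (forall A B, measurable A -> measurable B ->
    P (X @^-1` A `&` U @^-1` B) = (P (X @^-1` A) * P (U @^-1` B))%E) ->
  measurable S ->
  P [set w | S (X w, U w)] =
  (\int[mu]_x ((f x)%:E * P (U @^-1` (xsection S x))))%E.
Proof.
move=> [mX mf f0 fE] mU XU mS.
pose U' : {mfun T >-> T2} := HB.pack U (isMeasurableFun.Build _ _ _ _ _ mU).
pose PU := distribution P U'.
pose M : {measure set (measurableTypeR R * T2)%type -> \bar R} := (mu \x PU)%E.
pose F (t : measurableTypeR R * T2) : \bar R := (f t.1)%:E.
have mF : measurable_fun [set: measurableTypeR R * T2] F.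
  by apply/measurable_EFinP; apply: measurableT_comp.
have F0 t : (0 <= F t)%E by rewrite lee_fin f0.
have [m2 m2E] := @exists_density_measure _ _ R M F mF F0.
have m2I S' : measurable S' ->
    m2 S' = (\int[mu]_x ((f x)%:E * PU (xsection S' x)))%E.
  move=> mS'; rewrite m2E integral_mkcond /M (@fubini_tonelli1 _ _ _ _ _ mu PU)//; last 2 first.
  - by apply/measurable_restrict => //; exact: measurable_funTS.
  - by apply: erestrict_ge0.
  apply: eq_integral => x _; rewrite /fubini_F.
  rewrite -integral_cst; last exact: measurable_xsection.
  rewrite [RHS]integral_mkcond; apply: eq_integral => y _.
  by rewrite !patchE mem_xsection.
pose V (w : T) := (X w : measurableTypeR R, U w).
have mV : measurable_fun [set: T] V by apply: measurable_fun_pair.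
pose m1 : {measure set (measurableTypeR R * T2)%type -> \bar R} :=
  measure_function_pushforward__canonical__measure_function_Measure P mV.
rewrite -[RHS](m2I S mS); change (m1 S = m2 S).
apply: (@measure_eq_on_rectangles _ _ _ _ _ m1 m2) mS.
  by rewrite /m1/= /pushforward preimage_setT probability_setT ltry.
move=> A B mA mB.
transitivity (P (X @^-1` A `&` U @^-1` B)); first by [].
rewrite XU// fE// m2I; last exact: measurableX.
rewrite integral_mkcond -ge0_integralZr//; last 2 first.
- by apply/measurable_restrict => //; apply/measurable_EFinP; exact: measurable_funTS.
- by move=> x _; apply: erestrict_ge0 => ? _; rewrite lee_fin f0.
apply: eq_integral => x _; rewrite patchE.
case: ifPn => xA; first by rewrite in_xsectionX.
by rewrite notin_xsectionX// /PU (measure0 (distribution P U')) mule0 mul0e.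
Qed.

(** Two applications of [pair_density]. The first needs [X] to be independent of
    the pair [(Y, Z)] on all measurable sets of the plane, which extends from
    rectangles by uniqueness of measures. *)
Lemma triple_density (X Y Z : T -> R) (f g h : R -> R) (S : set (R * (R * R))) :
  has_pdf P X f -> has_pdf P Y g -> has_pdf P Z h -> independent3 P X Y Z ->
  measurable S ->
  P [set w | S (X w, (Y w, Z w))] =
  (\int[mu]_x \int[mu]_y \int[mu]_z
     (\1_S (x, (y, z)) * (f x * g y * h z))%:E)%E.
Proof.
move=> Xf Yg Zh XYZ mS.
have [mX mf f0 fE] := Xf; have [mY mg g0 gE] := Yg; have [mZ mh h0 hE] := Zh.
have YZ B C : measurable B -> measurable C ->
    P (Y @^-1` B `&` Z @^-1` C) = (P (Y @^-1` B) * P (Z @^-1` C))%E.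
  move=> mB mC; have := XYZ setT B C measurableT mB mC.
  by rewrite preimage_setT setTI probability_setT mul1e.
have mYZ : measurable_fun [set: T] (fun w => (Y w, Z w)) by exact: measurable_fun_pair.
have X_YZ A E : measurable A -> measurable E ->
    P (X @^-1` A `&` (fun w => (Y w, Z w)) @^-1` E) =
    (P (X @^-1` A) * P ((fun w => (Y w, Z w)) @^-1` E))%E.
  move=> mA mE.
  have mXA : measurable (X @^-1` A) by rewrite -[X in measurable X]setTI; exact: mX.
  (* [n1] is the law of [(Y, Z)] on the event [X \in A], and [n2] is that law
     scaled by the probability of the event. *)
  pose n1 : {measure set (R * R) -> \bar R} :=
    measure_function_pushforward__canonical__measure_function_Measure (mrestr P mXA) mYZ.
  pose c := fine (P (X @^-1` A)).
  have c0 : 0 <= c by rewrite fine_ge0.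
  pose n2 : {measure set (R * R) -> \bar R} := mscale (NngNum c0)
    (measure_function_pushforward__canonical__measure_function_Measure P mYZ).
  have cE : c%:E = P (X @^-1` A) by rewrite fineK// fin_num_measure.
  have /(_ E mE) : forall E, measurable E -> n1 E = n2 E.
    apply: measure_eq_on_rectangles.
      rewrite /n1/= /pushforward /mrestr/= preimage_setT setTI.
      by rewrite (le_lt_trans (probability_le1 _ _))// ltry.
    move=> B C mB mC; rewrite /n1 /n2/= /mscale/= /pushforward /mrestr/= cE.
    have -> : (fun w => (Y w, Z w)) @^-1` (B `*` C) = Y @^-1` B `&` Z @^-1` C by [].
    by rewrite YZ// muleA -XYZ// setIC setIA.
  by rewrite /n1 /n2/= /mscale/= /pushforward /mrestr/= cE setIC.
rewrite (pair_density Xf mYZ X_YZ mS); apply: eq_integral => x _.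
rewrite (pair_density Yg mZ YZ); last exact: measurable_xsection.
rewrite -ge0_integralZl//; last 3 first.
- apply: emeasurable_funM; first by apply/measurable_EFinP.
  pose Z' : {mfun T >-> R} :=
    HB.pack Z (isMeasurableFun.Build _ _ _ _ _ mZ).
  exact: (measurable_fun_xsection (distribution P Z') (measurable_xsection x mS)).
- by move=> y _; rewrite mule_ge0// lee_fin.
- by rewrite lee_fin.
apply: eq_integral => y _.
rewrite hE; last by do 2 apply: measurable_xsection.
rewrite integral_mkcond -ge0_integralZl//; last 3 first.
- apply/measurable_restrict => //; first by do 2 apply: measurable_xsection.
  by apply/measurable_EFinP; exact: measurable_funTS.
- by move=> z _; apply: erestrict_ge0 => ? _; rewrite lee_fin.
- by rewrite lee_fin.
rewrite -ge0_integralZl//; last 3 first.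
- apply: emeasurable_funM => //.
  apply/measurable_restrict => //; first by do 2 apply: measurable_xsection.
  by apply/measurable_EFinP; exact: measurable_funTS.
- by move=> z _; rewrite mule_ge0 ?lee_fin//; apply: erestrict_ge0 => ? _; rewrite lee_fin.
- by rewrite lee_fin.
apply: eq_integral => z _; rewrite patchE !mem_xsection indicE.
by case: ifPn => _; rewrite ?mule0 ?mul0r// mul1r -!EFinM mulrA.
Qed.

End joint_law.

(** * The law of a quadratic-form ratio as a series of kernels *)

Section ratio_kernel.
Context {R : realType}.
Local Notation mu := (@lebesgue_measure R).
Local Notation D := (`]0%R, +oo[%classic : set R).
Variables (p1 p2 q a r : R) (phi : R -> R).
Hypotheses (p1_gt0 : 0 < p1) (p2_gt0 : 0 < p2) (q_gt0 : 0 < q).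
Hypotheses (a_gt0 : 0 < a) (r_gt1 : 1 < r).
Hypotheses (mphi : measurable_fun [set: R] phi) (phi_ge0 : forall x, 0 <= phi x).

Let r_gt0 : 0 < r. Proof. exact: lt_trans r_gt1. Qed.

(** The chi-square density with [2 * p] degrees of freedom, up to its constant. *)
Definition gamma_kernel (p x : R) : R := x `^ (p - 1) * expR (- (2^-1 * x)).

Definition kappa : R := (1 - r^-1) / (2 * a).

(** [v_kernel] and [z_kernel] factor the integrand after both substitutions;
    [v_kernel] collects everything in which [z] does not occur. *)
Definition v_kernel (w v : R) : R :=
  r `^ p2 * (a * r) `^ (- (p1 + p2)) * w `^ (p1 + p2 - 1) *
  (v `^ (p1 + p2 + q - 1) * expR (- ((a + w) / (2 * a) * v))).

Definition z_kernel (w v z : R) : R :=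
  z `^ (p2 - 1) * (1 + z) `^ (- (p1 + p2)) *
  expR (kappa * w * v * (1 + z) `^ (-1)).

(** The integrand after the substitutions [y = r * x * z] and
    [x = w * v / (a * r * (1 + z))], whose Jacobians are the two leading
    factors on the left. They are chosen so that [(a * r * x + a * y) / v = w].
    The exponent [x + y + v] becomes
    [v * (a + w) / a - (1 - r^-1) * w * v / (a * (1 + z))]; half of its last
    term is the [kappa] part, the only place where [v] and [z] interact. *)
Lemma kernel_change (w v z : R) : 0 < w -> 0 < v -> 0 < z ->
  let x := w * v / (a * r * (1 + z)) in
  v / (a * r * (1 + z)) *
   (r * x * (gamma_kernel q v * gamma_kernel p1 x * gamma_kernel p2 (r * x * z))) =
  v_kernel w v * z_kernel w v z.
Proof.
move=> w0 v0 z0 x.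
have z1 : 0 < 1 + z by rewrite addr_gt0.
have arz : 0 < a * r * (1 + z) by rewrite !mulr_gt0.
have ar : 0 < a * r by rewrite mulr_gt0.
have x0 : 0 < x by rewrite divr_gt0// mulr_gt0.
have rx0 : 0 < r * x by rewrite mulr_gt0.
have rxz0 : 0 < r * x * z by rewrite mulr_gt0.
have powE (y t : R) : 0 < y -> y `^ t = expR (t * ln y) by move=> y0; rewrite /powR gt_eqF.
rewrite /gamma_kernel /v_kernel /z_kernel powR_inv1 ?(ltW z1)//.
rewrite !(powE v)// !(powE x)// !(powE (r * x * z))// !(powE r)// !(powE (a * r))//.
rewrite !(powE w)// !(powE z)// !(powE (1 + z))//.
have lnarz : ln (a * r * (1 + z)) = ln a + ln r + ln (1 + z) by rewrite !lnM ?posrE.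
have lnx : ln x = ln w + ln v - (ln a + ln r + ln (1 + z)).
  by rewrite /x ln_div ?posrE ?mulr_gt0// lnarz lnM ?posrE.
have lnrx : ln (r * x) = ln r + ln x by rewrite lnM ?posrE.
have lnrxz : ln (r * x * z) = ln r + ln x + ln z by rewrite lnM ?posrE// lnrx.
have lnar : ln (a * r) = ln a + ln r by rewrite lnM ?posrE.
have -> : v / (a * r * (1 + z)) = expR (ln v - (ln a + ln r + ln (1 + z))).
  by rewrite -lnarz -ln_div ?posrE// lnK// posrE divr_gt0.
(* Only the Jacobian occurrence of [r * x] is turned into an exponential; the
   occurrences inside [expR] must stay for the final field identity. *)
have E : r * x = expR (ln r + ln x) by rewrite -lnrx lnK// posrE.
rewrite [X in _ * (X * _)]E -!expRD lnrxz lnar.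
congr expR; rewrite lnx /x /kappa.
field.
by rewrite !gt_eqF.
Qed.

Definition beta_coef (j : nat) : R :=
  Gamma (p1 + j%:R) * Gamma p2 / Gamma (p1 + j%:R + p2).

Lemma beta_coef_ge0 j : 0 <= beta_coef j.
Proof.
have pj : 0 < p1 + j%:R by rewrite ltr_wpDr.
have pj2 : 0 < p1 + j%:R + p2 by rewrite addr_gt0.
by rewrite divr_ge0 ?mulr_ge0// ltW// Gamma_gt0.
Qed.

Lemma kappa_gt0 : 0 < kappa.
Proof. by rewrite divr_gt0 ?mulr_gt0// subr_gt0 invf_lt1. Qed.

(** Expand the exponential in powers of [(1 + z)^-1]; each term is a beta-prime
    integral. All terms are nonnegative because [1 < r], so monotone
    convergence justifies the exchange. *)
Lemma integral_z_kernel (w v : R) : 0 < w -> 0 < v ->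
  (\int[mu]_(z in D) (z_kernel w v z)%:E =
   \sum_(j <oo) ((kappa * w * v) ^+ j / j`!%:R * beta_coef j)%:E)%E.
Proof.
move=> w0 v0.
have k0 : 0 <= kappa * w * v by rewrite (ltW (mulr_gt0 (mulr_gt0 kappa_gt0 w0) v0)).
pose c j : R := (kappa * w * v) ^+ j / j`!%:R.
have c0 j : 0 <= c j by rewrite divr_ge0// exprn_ge0.
pose e j (z : R) : R := z `^ (p2 - 1) * (1 + z) `^ (- (p1 + j%:R + p2)).
have e0 j z : 0 <= e j z by rewrite mulr_ge0 ?powR_ge0.
transitivity (\int[mu]_(z in D) \sum_(j <oo) (c j * e j z)%:E)%E.
  apply: eq_integral => z; rewrite inE/= in_itv/= andbT => z0.
  have z1 : 0 < 1 + z by rewrite addr_gt0.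
  have kz0 : 0 <= kappa * w * v * (1 + z) `^ (-1) by rewrite mulr_ge0 ?powR_ge0.
  rewrite /z_kernel EFinM expRE_nneseries//.
  rewrite -nneseriesZl; last first.
    by move=> j _; rewrite lee_fin divr_ge0// exprn_ge0.
  apply: eq_eseriesr => j _.
  rewrite -EFinM; congr EFin.
  rewrite exprMn_comm; last exact: mulrC.
  rewrite -(@powR_mulrn _ ((1 + z) `^ (-1))) ?powR_ge0// -powRrM mulN1r.
  rewrite /c /e (_ : - (p1 + j%:R + p2) = - (p1 + p2) + - j%:R); last by ring.
  by rewrite (@powRD _ (1 + z)) ?(gt_eqF z1) ?implybT//; ring.
rewrite integral_nneseries//; last 2 first.
- by move=> j; apply/measurable_EFinP; prove_measurable.
- by move=> j z _; rewrite lee_fin mulr_ge0.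
apply: eq_eseriesr => j _.
under eq_integral do rewrite EFinM.
rewrite ge0_integralZl//; last 3 first.
- by apply/measurable_EFinP; prove_measurable.
- by move=> z _; rewrite lee_fin.
- by rewrite lee_fin.
rewrite /e integral_beta ?ltr_wpDr//.
Qed.

(** The contribution of the [j]-th power to the density, up to the constants that
    normalise the gamma kernels. *)
Definition ratio_term (w : R) (j : nat) : R :=
  r `^ p2 * (a * r) `^ (- (p1 + p2)) * w `^ (p1 + p2 - 1) *
  ((kappa * w) ^+ j / j`!%:R * beta_coef j) *
  (((a + w) / (2 * a)) `^ (- (p1 + p2 + q + j%:R)) * Gamma (p1 + p2 + q + j%:R)).

Lemma ratio_term_ge0 (w : R) (j : nat) : 0 < w -> 0 <= ratio_term w j.
Proof.
move=> w0; apply: mulr_ge0; last first.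
  by rewrite mulr_ge0 ?powR_ge0// ltW// Gamma_gt0// ltr_wpDr// !addr_gt0.
apply: mulr_ge0; first by rewrite !mulr_ge0 ?powR_ge0.
apply: mulr_ge0; last exact: beta_coef_ge0.
by rewrite divr_ge0// exprn_ge0// (ltW (mulr_gt0 kappa_gt0 w0)).
Qed.

Lemma integral_v_kernel (w : R) (j : nat) : 0 < w ->
  (\int[mu]_(v in D) (v_kernel w v * ((kappa * w * v) ^+ j / j`!%:R * beta_coef j))%:E =
   (ratio_term w j)%:E)%E.
Proof.
move=> w0.
have aw0 : 0 < (a + w) / (2 * a) by rewrite divr_gt0 ?mulr_gt0 ?addr_gt0.
pose K := r `^ p2 * (a * r) `^ (- (p1 + p2)) * w `^ (p1 + p2 - 1) *
  ((kappa * w) ^+ j / j`!%:R * beta_coef j).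
have K0 : 0 <= K.
  apply: mulr_ge0; first by rewrite !mulr_ge0 ?powR_ge0.
  apply: mulr_ge0; last exact: beta_coef_ge0.
  by rewrite divr_ge0// exprn_ge0// (ltW (mulr_gt0 kappa_gt0 w0)).
transitivity (\int[mu]_(v in D) (K%:E * (v `^ (p1 + p2 + q + j%:R - 1) *
    expR (- ((a + w) / (2 * a) * v)))%:E))%E.
  apply: eq_integral => v; rewrite inE/= in_itv/= andbT => v0.
  rewrite -EFinM; congr EFin; rewrite /K /v_kernel (@exprMn_comm _ _ v); last exact: mulrC.
  rewrite -(@powR_mulrn _ v) ?ltW//.
  rewrite (_ : p1 + p2 + q + j%:R - 1 = p1 + p2 + q - 1 + j%:R); last by ring.
  by rewrite (@powRD _ v (p1 + p2 + q - 1)) ?(gt_eqF v0) ?implybT//; ring.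
rewrite ge0_integralZl//; last 2 first.
- by apply/measurable_EFinP; prove_measurable.
- by move=> v _; rewrite lee_fin mulr_ge0 ?powR_ge0 ?expR_ge0.
rewrite integral_gamma// -GammaE -?EFinM//.
by rewrite ltr_wpDr// !addr_gt0.
Qed.

Lemma measurable_gamma_kernel p : measurable_fun [set: R] (gamma_kernel p).
Proof. by rewrite /gamma_kernel; prove_measurable. Qed.

Ltac prove_kernel_measurable := repeat progress (prove_measurable; repeat first
  [ apply: (measurableT_comp mphi) | apply: (measurableT_comp (measurable_gamma_kernel _)) ]).

(** Up to constants the left side is the expectation of [phi] at the ratio.
    After the two substitutions of [kernel_change] the ratio itself is an
    integration variable, and Tonelli moves it to the outside. *)
Lemma integral_ratio :
  (\int[mu]_(v in D) \int[mu]_(x in D) \int[mu]_(y in D)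
     (phi ((a * r * x + a * y) / v) *
        (gamma_kernel q v * gamma_kernel p1 x * gamma_kernel p2 y))%:E =
   \int[mu]_(w in D) \sum_(j <oo) (phi w * ratio_term w j)%:E)%E.
Proof.
have g0 p x : 0 <= gamma_kernel p x by rewrite mulr_ge0 ?powR_ge0 ?expR_ge0.
have ck0 w v : 0 <= v_kernel w v by rewrite !mulr_ge0 ?powR_ge0 ?expR_ge0.
have zk0 w v z : 0 <= z_kernel w v z by rewrite !mulr_ge0 ?powR_ge0 ?expR_ge0.
have cj0 w v j : 0 < w -> 0 < v -> 0 <= (kappa * w * v) ^+ j / j`!%:R * beta_coef j.
  move=> w0 v0; apply: mulr_ge0; last exact: beta_coef_ge0.
  by rewrite divr_ge0// exprn_ge0// (ltW (mulr_gt0 (mulr_gt0 kappa_gt0 w0) v0)).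
pose ck w v j : R := phi w * (v_kernel w v * ((kappa * w * v) ^+ j / j`!%:R * beta_coef j)).
have ck_ge0 w v j : 0 < w -> 0 < v -> 0 <= ck w v j.
  by move=> w0 v0; apply: mulr_ge0 => //; apply: mulr_ge0 => //; exact: cj0.
transitivity (\int[mu]_(v in D) \int[mu]_(w in D) \sum_(j <oo) (ck w v j)%:E)%E.
  apply: eq_integral => v; rewrite inE/= in_itv/= andbT => v0.
  (* First substitution, [y = r * x * z]. *)
  transitivity (\int[mu]_(x in D) \int[mu]_(z in D)
      (r * x * (phi ((a * r * x + a * (r * x * z)) / v) *
       (gamma_kernel q v * gamma_kernel p1 x * gamma_kernel p2 (r * x * z))))%:E)%E.
    apply: eq_integral => x; rewrite inE/= in_itv/= andbT => x0.
    have rx0 : 0 < r * x by rewrite mulr_gt0.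
    rewrite (integral_positive_scale rx0)//; last 2 first.
    - by apply/measurable_EFinP; prove_kernel_measurable.
    - by move=> y _; rewrite lee_fin !mulr_ge0 ?powR_ge0 ?expR_ge0.
  rewrite tonelli_positive; last 2 first.
  - by apply: measurable_funTS; apply/measurable_EFinP; prove_kernel_measurable.
  - move=> x z; rewrite /= !in_itv/= !andbT => x0 z0.
    by rewrite lee_fin !mulr_ge0 ?powR_ge0 ?expR_ge0 ?(ltW r_gt0) ?(ltW x0).
  (* Second substitution, [x = v / (a * r * (1 + z)) * w]. *)
  transitivity (\int[mu]_(z in D) \int[mu]_(w in D)
      (phi w * (v_kernel w v * z_kernel w v z))%:E)%E.
    apply: eq_integral => z; rewrite inE/= in_itv/= andbT => z0.
    have c0 : 0 < v / (a * r * (1 + z)) by rewrite divr_gt0// !mulr_gt0// addr_gt0.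
    rewrite (integral_positive_scale c0)//; last 2 first.
    - by apply/measurable_EFinP; prove_kernel_measurable.
    - move=> x; rewrite /= in_itv/= andbT => x0.
      by rewrite lee_fin !mulr_ge0 ?powR_ge0 ?expR_ge0 ?(ltW r_gt0) ?(ltW x0).
    apply: eq_integral => w; rewrite inE/= in_itv/= andbT => w0.
    rewrite /= -EFinM; congr EFin; rewrite -kernel_change//.
    have z1 : 1 + z != 0 by rewrite gt_eqF// addr_gt0.
    set x := v / (a * r * (1 + z)) * w.
    have -> : (a * r * x + a * (r * x * z)) / v = w.
      by rewrite /x; field; rewrite z1 !gt_eqF.
    have -> : x = w * v / (a * r * (1 + z)) by rewrite /x mulrC mulrA.
    by ring.
  rewrite tonelli_positive; last 2 first.
  - apply: measurable_funTS; apply/measurable_EFinP; rewrite /v_kernel /z_kernel.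
    prove_kernel_measurable.
  - by move=> z w _ _; rewrite lee_fin !mulr_ge0 ?powR_ge0 ?expR_ge0.
  apply: eq_integral => w; rewrite inE/= in_itv/= andbT => w0.
  under eq_integral do rewrite mulrA EFinM.
  rewrite ge0_integralZl//; last 3 first.
  - by apply/measurable_EFinP; rewrite /z_kernel; prove_kernel_measurable.
  - by move=> z _; rewrite lee_fin !mulr_ge0 ?powR_ge0 ?expR_ge0.
  - by rewrite lee_fin !mulr_ge0 ?powR_ge0 ?expR_ge0.
  rewrite integral_z_kernel// -nneseriesZl; last first.
    by move=> j _; rewrite lee_fin cj0.
  by apply: eq_eseriesr => j _; rewrite -EFinM /ck mulrA.
rewrite tonelli_positive; last 2 first.
- apply: ge0_emeasurable_sum => [j [v w] [/=] | j _].
    by rewrite !in_itv/= !andbT => v0 w0 _; rewrite lee_fin ck_ge0.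
  apply: measurable_funTS; apply/measurable_EFinP; rewrite /ck /v_kernel; prove_kernel_measurable.
- move=> v w; rewrite /= !in_itv/= !andbT => v0 w0.
  by apply: nneseries_ge0 => j _ _; rewrite lee_fin ck_ge0.
apply: eq_integral => w; rewrite inE/= in_itv/= andbT => w0.
rewrite integral_nneseries//; last 2 first.
- by move=> j; apply/measurable_EFinP; rewrite /ck /v_kernel; prove_kernel_measurable.
- by move=> j v; rewrite /= in_itv/= andbT => v0; rewrite lee_fin ck_ge0.
apply: eq_eseriesr => j _.
under eq_integral do rewrite /ck EFinM.
rewrite ge0_integralZl//; last 3 first.
- by apply/measurable_EFinP; rewrite /v_kernel; prove_kernel_measurable.
- by move=> v; rewrite /= in_itv/= andbT => v0; rewrite lee_fin mulr_ge0 ?cj0.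
- by rewrite lee_fin.
by rewrite integral_v_kernel// EFinM.
Qed.

End ratio_kernel.

(** * Convergence and closed form of the series *)

Section hypergeometric_terms.
Context {R : realType}.
Local Notation mu := (@lebesgue_measure R).
Local Notation D := (`]0%R, +oo[%classic : set R).

(** Multiply by [Gamma s]: the coefficients become [Gamma (s + j%:R) / j`!], the
    sum of the corresponding gamma integrals is the integral of
    [v `^ (s - 1) * expR (- ((1 - x) * v))]. *)
Lemma negative_binomial_series (s x : R) : 0 < s -> 0 <= x -> x < 1 ->
  (\sum_(j <oo) (pochhammer s j / j`!%:R * x ^+ j)%:E)%E =
  ((1 - x) `^ (- s))%:E.
Proof.
move=> s0 x0 x1.
have G0 := Gamma_gt0 s0.
have c0 j : 0 <= pochhammer s j / j`!%:R * x ^+ j.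
  by rewrite !mulr_ge0 ?invr_ge0 ?exprn_ge0// ltW// pochhammer_gt0.
suff E : ((Gamma s)%:E * (\sum_(j <oo) (pochhammer s j / j`!%:R * x ^+ j)%:E) =
          (Gamma s)%:E * ((1 - x) `^ (- s))%:E)%E.
  have := congr1 (fun y => (Gamma s)^-1%:E * y)%E E.
  by rewrite !muleA -!EFinM mulVf ?gt_eqF// mul1r mul1e.
rewrite [RHS]muleC [in RHS]GammaE// -integral_gamma ?subr_gt0//.
rewrite -nneseriesZl; last by move=> j _; rewrite lee_fin.
transitivity (\int[mu]_(v in D) \sum_(j <oo)
    (x ^+ j / j`!%:R * (v `^ (s + j%:R - 1) * expR (- (1 * v))))%:E)%E.
  rewrite integral_nneseries//; last 2 first.
  - by move=> j; apply/measurable_EFinP; prove_measurable.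
  - move=> j v _; rewrite lee_fin mulr_ge0 ?divr_ge0 ?exprn_ge0//.
    by rewrite mulr_ge0 ?powR_ge0 ?expR_ge0.
  apply: eq_eseriesr => j _.
  under eq_integral do rewrite EFinM.
  rewrite ge0_integralZl//; last 3 first.
  - by apply/measurable_EFinP; prove_measurable.
  - by move=> v _; rewrite lee_fin mulr_ge0 ?powR_ge0 ?expR_ge0.
  - by rewrite lee_fin divr_ge0 ?exprn_ge0.
  rewrite integral_gamma// powR1 mul1e -!GammaE ?ltr_wpDr// Gamma_addn//.
  by rewrite -!EFinM; congr EFin; ring.
apply: eq_integral => v; rewrite inE/= in_itv/= andbT => v0.
have xv0 : 0 <= x * v by rewrite mulr_ge0 ?(ltW v0).
transitivity ((v `^ (s - 1) * expR (- v))%:E * (expR (x * v))%:E)%E; last first.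
  rewrite -EFinM -mulrA -expRD; congr (_ * expR _)%:E; ring.
rewrite expRE_nneseries// -nneseriesZl; last first.
  by move=> j _; rewrite lee_fin divr_ge0// exprn_ge0.
apply: eq_eseriesr => j _.
rewrite -EFinM; congr EFin.
rewrite (_ : s + j%:R - 1 = s - 1 + j%:R); last by ring.
rewrite (@powRD _ v) ?(gt_eqF v0) ?implybT// powR_mulrn ?ltW// mul1r.
by rewrite (exprMn_comm j (mulrC x v)); ring.
Qed.

Lemma nneseries_cvgn_lim (u : R^nat) : (forall j, 0 <= u j) ->
  (\sum_(j <oo) (u j)%:E < +oo)%E ->
  cvgn (series u) /\ (limn (series u))%:E = (\sum_(j <oo) (u j)%:E)%E.
Proof.
move=> u0 uoo.
have cu : cvgn (series u).
  apply: nondecreasing_is_cvgn.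
    by apply: nondecreasing_series.
  exists (fine (\sum_(j <oo) (u j)%:E)) => _ [n _ <-].
  rewrite -lee_fin fineK; last first.
    by rewrite ge0_fin_numE//; apply: nneseries_ge0 => j _ _; rewrite lee_fin.
  rewrite /series/= -sumEFin; apply: nneseries_lim_ge => j _; by rewrite lee_fin.
split => //; rewrite -EFin_lim//.
by congr (limn _); apply/funext => n /=; rewrite /series/= -sumEFin.
Qed.

Lemma pochhammer_le (b c : R) j : 0 < b -> b <= c -> pochhammer b j <= pochhammer c j.
Proof.
move=> b0 bc; elim: j => [|j IH]; first by rewrite /pochhammer !big_geq.
rewrite !pochhammerS ler_pM// ?lerD2r// ltW// ?pochhammer_gt0//.
by rewrite ltr_wpDr.
Qed.

Definition hyp_term (b c e x : R) (j : nat) : R :=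
  pochhammer b j * pochhammer c j / (j`!%:R * pochhammer e j) * x ^+ j.

Lemma hyp_term_ge0 b c e x j : 0 < b -> 0 < c -> 0 < e -> 0 <= x ->
  0 <= hyp_term b c e x j.
Proof.
move=> b0 c0 e0 x0; apply: mulr_ge0; last exact: exprn_ge0.
by rewrite divr_ge0// mulr_ge0// ltW// pochhammer_gt0.
Qed.

(** Since [c <= e], the quotient of Pochhammer symbols in [c] and [e] is at most
    1, and the negative binomial series dominates. *)
Lemma hyp_term_summable b c e x : 0 < b -> 0 < c -> c <= e -> 0 <= x -> x < 1 ->
  (\sum_(j <oo) (hyp_term b c e x j)%:E < +oo)%E.
Proof.
move=> b0 c0 ce x0 x1.
have e0 : 0 < e by exact: lt_le_trans ce.
have le : (\sum_(j <oo) (hyp_term b c e x j)%:E <= ((1 - x) `^ (- b))%:E)%E.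
  rewrite -negative_binomial_series//.
  apply: lee_nneseries => [j _ _|j _]; rewrite lee_fin; first exact: hyp_term_ge0.
  rewrite /hyp_term ler_wpM2r ?exprn_ge0//.
  have pe := pochhammer_gt0 j e0.
  have -> : pochhammer b j * pochhammer c j / (j`!%:R * pochhammer e j) =
      pochhammer b j / j`!%:R * (pochhammer c j / pochhammer e j).
    by field; rewrite pnatr_eq0 -lt0n fact_gt0 gt_eqF.
  rewrite ler_piMr ?divr_ge0// ?(ltW (pochhammer_gt0 j b0))//.
  by rewrite ler_pdivrMr// mul1r pochhammer_le.
by rewrite (le_lt_trans le)// ltry.
Qed.

(** The constants on the left normalise the three gamma kernels. Every gamma
    value at a shift by [j] is a Pochhammer symbol times its value at [j = 0];
    what remains is an identity between powers, checked on logarithms. *)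
Lemma ratio_term_hyp (p1 p2 q a r w : R) j :
  0 < p1 -> 0 < p2 -> 0 < q -> 0 < a -> 1 < r -> 0 < w ->
  (2 `^ q * Gamma q)^-1 * (2 `^ p1 * Gamma p1)^-1 * (2 `^ p2 * Gamma p2)^-1 *
    ratio_term p1 p2 q a r w j =
  r `^ (- p1) * (a `^ q * (Gamma (p1 + p2 + q) / (Gamma (p1 + p2) * Gamma q))) *
  (w `^ (p1 + p2 - 1) / (a + w) `^ (p1 + p2 + q)) *
  hyp_term (p1 + p2 + q) p1 (p1 + p2) ((1 - r^-1) * (w / (a + w))) j.
Proof.
move=> p10 p20 q0 a0 r1 w0.
have r0 : 0 < r by exact: lt_trans r1.
have aw0 : 0 < a + w by rewrite addr_gt0.
have p0 : 0 < p1 + p2 by rewrite addr_gt0.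
have pq0 : 0 < p1 + p2 + q by rewrite addr_gt0.
have f0 : (j`!%:R : R) != 0 by rewrite pnatr_eq0 -lt0n fact_gt0.
rewrite /ratio_term /hyp_term /beta_coef /kappa.
rewrite (_ : p1 + j%:R + p2 = p1 + p2 + j%:R); last by ring.
rewrite !Gamma_addn//.
have := pochhammer_gt0 j p0; have := Gamma_gt0 p10; have := Gamma_gt0 p20.
have := Gamma_gt0 q0; have := Gamma_gt0 p0; have := Gamma_gt0 pq0.
move: (Gamma p1) (Gamma p2) (Gamma q) (Gamma (p1 + p2)) (Gamma (p1 + p2 + q)) => g1 g2 gq gp gpq.
move: (pochhammer _ j) (pochhammer _ j) (pochhammer _ j) => P1 P2 P3 gpq0 gp0 gq0 g20 g10 P20.
have pw : 2 `^ q * 2 `^ p1 * 2 `^ p2 * r `^ (- p1) * a `^ q / (a + w) `^ (p1 + p2 + q) =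
   r `^ p2 * (a * r) `^ (- (p1 + p2)) * ((a + w) / (2 * a)) `^ (- (p1 + p2 + q)).
  have powE (y t : R) : 0 < y -> y `^ t = expR (t * ln y) by move=> y0; rewrite /powR gt_eqF.
  have a2 : 0 < 2 * a by rewrite mulr_gt0.
  have a2w : 0 < (a + w) / (2 * a) by rewrite divr_gt0.
  have ar : 0 < a * r by rewrite mulr_gt0.
  rewrite -powRN !powE// ln_div ?posrE// !lnM ?posrE// -!expRD; congr expR; ring.
have a2w : 0 < (a + w) / (2 * a) by rewrite divr_gt0// mulr_gt0.
have xj : ((1 - r^-1) / (2 * a) * w) ^+ j * ((a + w) / (2 * a)) `^ (- j%:R) =
    ((1 - r^-1) * (w / (a + w))) ^+ j.
  rewrite powRN powR_mulrn ?(ltW a2w)// -exprVn -exprMn; congr (_ ^+ j).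
  by field; rewrite !gt_eqF.
rewrite (_ : - (p1 + p2 + q + j%:R) = - (p1 + p2 + q) + - j%:R); last by ring.
rewrite (@powRD _ ((a + w) / (2 * a))) ?(gt_eqF a2w) ?implybT// -xj.
move: pw.
have : 0 < (a + w) `^ (p1 + p2 + q) by rewrite powR_gt0.
have : 0 < (2 : R) `^ q by rewrite powR_gt0.
have : 0 < (2 : R) `^ p1 by rewrite powR_gt0.
have : 0 < (2 : R) `^ p2 by rewrite powR_gt0.
move: (((1 - r^-1) / (2 * a) * w) ^+ j) (((a + w) / (2 * a)) `^ _) (((a + w) / (2 * a)) `^ _).
move: (r `^ _) (r `^ _) ((a * r) `^ _) (a `^ _) ((a + w) `^ _) (2 `^ _) (2 `^ _) (2 `^ _) (w `^ _).
move=> x1 x2 x3 x4 x5 x6 x7 x8 x9 x10 x11 x12 x80 x70 x60 x50 pw.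
transitivity ((x6 * gq)^-1 / (x7 * g1) / (x8 * g2) * (x1 * x3 * x12) *
  (x9 * (x10 / j`!%:R * (P2 * g1 * g2 / (P3 * gp))) * (x11 * (P1 * gpq)))).
  by ring.
by rewrite -pw; field; rewrite f0 !gt_eqF.
Qed.

End hypergeometric_terms.

(** * The density of the ratio *)

Section chi_square_density.
Context {R : realType}.
Local Notation mu := (@lebesgue_measure R).
Local Notation D := (`]0%R, +oo[%classic : set R).

(** [x^-1 = x / x ^+ 2] reduces inversion to real powers of a nonnegative
    quantity, for which measurability is known. *)
Lemma measurable_inv : measurable_fun [set: R] (fun x : R => x^-1).
Proof.
(* At 0 both sides vanish, by the convention [0^-1 = 0]. *)
have -> : (fun x : R => x^-1) = (fun x => x * (x * x) `^ (-1)).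
  apply/funext => x; rewrite powR_inv1 ?sqr_ge0//.
  have [->|x0] := eqVneq x 0; first by rewrite invr0 mul0r.
  by rewrite invfM mulrA divff// mul1r.
by prove_measurable.
Qed.

Lemma integral_eq0_npos (f : R -> \bar R) : (forall x, x <= 0 -> f x = 0%E) ->
  (\int[mu]_x f x = \int[mu]_(x in D) f x)%E.
Proof.
move=> f0; rewrite [RHS]integral_mkcond; apply: eq_integral => x _.
rewrite patchE; case: ifPn => //; rewrite notin_setE/= in_itv/= andbT => /negP.
by rewrite -leNgt; exact: f0.
Qed.

Definition chi2_cst (k : nat) : R := (2 `^ (k%:R / 2) * Gamma (k%:R / 2))^-1.

Lemma chi2_pdf_le0 k (x : R) : x <= 0 -> chi2_pdf k x = 0.
Proof. by move=> x0; rewrite /chi2_pdf ltNge x0. Qed.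

Lemma chi2_pdf_gt0 k (x : R) : 0 < x ->
  chi2_pdf k x = chi2_cst k * gamma_kernel (k%:R / 2) x.
Proof.
move=> x0; rewrite /chi2_pdf x0 /chi2_cst /gamma_kernel mulrC.
by congr (_ * (_ * expR _)); rewrite mulNr mulrC.
Qed.

Lemma chi2_cst_ge0 k : (0 < k)%N -> 0 <= chi2_cst k.
Proof.
move=> k0; rewrite invr_ge0 mulr_ge0 ?powR_ge0// ltW// Gamma_gt0//.
by rewrite divr_gt0// ltr0n.
Qed.

End chi_square_density.

Section law_of_ratio.
Context (R : realType) (d : measure_display) (T : measurableType d).
Local Notation mu := (@lebesgue_measure R).
Local Notation D := (`]0%R, +oo[%classic : set R).
Variables (P : probability T R) (X1 X2 V : T -> R) (m1 m2 nu : nat).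
Variables (alpha1 alpha2 m : R).
Hypotheses (m1_gt0 : (0 < m1)%N) (m2_gt0 : (0 < m2)%N) (nu_gt0 : (0 < nu)%N).
Hypotheses (X1_chi2 : chi_square P m1 X1) (X2_chi2 : chi_square P m2 X2).
Hypotheses (V_chi2 : chi_square P nu V) (indep : independent3 P X1 X2 V).
Hypotheses (alpha2_gt0 : 0 < alpha2) (alpha21 : alpha2 < alpha1) (m_gt0 : 0 < m).

Let W (w : T) : R := ((alpha1 * X1 w + alpha2 * X2 w) / m) / (V w / nu%:R).
Let a : R := nu%:R * alpha2 / m.
Let r : R := alpha1 / alpha2.
Let p1 : R := m1%:R / 2.
Let p2 : R := m2%:R / 2.
Let q : R := nu%:R / 2.
Let C : R := chi2_cst nu * chi2_cst m1 * chi2_cst m2.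

Let Wfun (t : R * (R * R)) : R :=
  ((alpha1 * t.2.1 + alpha2 * t.2.2) / m) / (t.1 / nu%:R).

Let measurable_Wfun : measurable_fun [set: R * (R * R)] Wfun.
Proof.
rewrite /Wfun; apply: measurable_funM.
  apply: measurable_funM => //; apply: measurable_funD.
    by apply: measurable_funM => //; apply: measurableT_comp.
  by apply: measurable_funM => //; apply: measurableT_comp.
apply: (measurableT_comp measurable_inv).
by apply: measurable_funM.
Qed.

Let mX1 : measurable_fun [set: T] X1. Proof. by case: X1_chi2. Qed.
Let mX2 : measurable_fun [set: T] X2. Proof. by case: X2_chi2. Qed.
Let mV : measurable_fun [set: T] V. Proof. by case: V_chi2. Qed.

Lemma measurable_W : measurable_fun [set: T] W.
Proof.
apply: (measurableT_comp (f := Wfun) (g := fun w => (V w, (X1 w, X2 w)))) => //.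
by apply: measurable_fun_pair => //; exact: measurable_fun_pair.
Qed.

Let r_gt1 : 1 < r.
Proof. by rewrite /r ltr_pdivlMr// mul1r. Qed.

Let a_gt0 : 0 < a.
Proof. by rewrite divr_gt0// mulr_gt0// ltr0n. Qed.

Let half_gt0 (k : nat) : (0 < k)%N -> 0 < k%:R / 2 :> R.
Proof. by move=> k0; rewrite divr_gt0// ltr0n. Qed.

Let C_ge0 : 0 <= C.
Proof. by rewrite !mulr_ge0// chi2_cst_ge0. Qed.

Lemma law_ratio (A : set R) : measurable A ->
  P (W @^-1` A) =
  (\int[mu]_(w in D) \sum_(j <oo) ((C * \1_A w) * ratio_term p1 p2 q a r w j)%:E)%E.
Proof.
move=> mA.
pose S := Wfun @^-1` A.
have mS : measurable S by rewrite /S -[X in measurable X]setTI; exact: measurable_Wfun.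
(* [V] comes first so that it is the outermost integration variable. *)
have indep' : independent3 P V X1 X2.
  move=> B C1 C2 mB mC1 mC2.
  by rewrite -setIA setIC indep// muleC muleA.
have p1_gt0 : 0 < p1 by exact: (half_gt0 m1_gt0).
have p2_gt0 : 0 < p2 by exact: (half_gt0 m2_gt0).
have q_gt0 : 0 < q by exact: (half_gt0 nu_gt0).
(* The normalising constant is carried by the test function, so that no
   constant has to be moved out of an iterated integral. *)
have mphi : measurable_fun [set: R] (fun w => C * \1_A w).
  by apply: measurable_funM => //; exact: measurable_indic.
have phi0 w : 0 <= C * \1_A w by rewrite mulr_ge0.
rewrite -(integral_ratio p1_gt0 p2_gt0 q_gt0 a_gt0 r_gt1 mphi phi0).
transitivity (P [set w | S (V w, (X1 w, X2 w))]); first by [].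
rewrite (triple_density V_chi2 X1_chi2 X2_chi2 indep' mS).
rewrite integral_eq0_npos; last first.
  move=> v v0; rewrite integral0_eq// => x _; rewrite integral0_eq// => y _.
  by rewrite (chi2_pdf_le0 _ v0) !mul0r mulr0.
apply: eq_integral => v; rewrite inE/= in_itv/= andbT => v0.
rewrite integral_eq0_npos; last first.
  move=> x x0; rewrite integral0_eq// => y _.
  by rewrite (chi2_pdf_le0 _ x0) mulr0 mul0r mulr0.
apply: eq_integral => x; rewrite inE/= in_itv/= andbT => x0.
rewrite integral_eq0_npos; last first.
  by move=> y y0; rewrite (chi2_pdf_le0 _ y0) !mulr0.
apply: eq_integral => y; rewrite inE/= in_itv/= andbT => y0.
congr EFin.
rewrite !chi2_pdf_gt0// -/p1 -/p2 -/q /C.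
have WE : Wfun (v, (x, y)) = (a * r * x + a * y) / v.
  rewrite /Wfun /a /r/=; field.
  by rewrite !gt_eqF ?ltr0n.
have -> : \1_S (v, (x, y)) = \1_A ((a * r * x + a * y) / v) :> R.
  rewrite !indicE; congr ((_ : bool)%:R); apply/idP/idP; rewrite !inE /S/=.
    by rewrite WE.
  by rewrite -WE.
move: (chi2_cst nu) (chi2_cst m1) (chi2_cst m2) (\1_A _ : R).
move: (gamma_kernel q v) (gamma_kernel p1 x) (gamma_kernel p2 y).
by move=> g1 g2 g3 c1 c2 c3 i; ring.
Qed.

Let hyp_x (w : R) : R := (1 - alpha2 / alpha1) * (w / (a + w)).

Definition W_density (w : R) : R :=
  r `^ (- p1) * (a `^ q * (Gamma (p1 + p2 + q) / (Gamma (p1 + p2) * Gamma q))) *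
  (w `^ (p1 + p2 - 1) / (a + w) `^ (p1 + p2 + q)) *
  limn (series (hyp_term (p1 + p2 + q) p1 (p1 + p2) (hyp_x w))).

Lemma hyp_x_bounds w : 0 < w -> 0 <= hyp_x w < 1.
Proof.
move=> w0; have aw : 0 < a + w by rewrite addr_gt0.
have alpha1_gt0 : 0 < alpha1 by exact: lt_trans alpha21.
have u0 : 0 <= 1 - alpha2 / alpha1 by rewrite subr_ge0 ler_pdivrMr// mul1r ltW.
have t0 : 0 <= w / (a + w) by rewrite divr_ge0 ?ltW.
apply/andP; split; first exact: mulr_ge0.
apply: (@le_lt_trans _ _ (w / (a + w))); last by rewrite ltr_pdivrMr// mul1r ltrDr.
by rewrite ler_piMl// gerBl divr_ge0 ?ltW.
Qed.

Lemma W_density_series w : 0 < w ->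
  cvgn (series (hyp_term (p1 + p2 + q) p1 (p1 + p2) (hyp_x w))) /\
  (W_density w)%:E = (\sum_(j <oo) (C * ratio_term p1 p2 q a r w j)%:E)%E.
Proof.
move=> w0; have /andP[x0 x1] := hyp_x_bounds w0.
have p1_gt0 : 0 < p1 by exact: (half_gt0 m1_gt0).
have p2_gt0 : 0 < p2 by exact: (half_gt0 m2_gt0).
have q_gt0 : 0 < q by exact: (half_gt0 nu_gt0).
have p_gt0 : 0 < p1 + p2 by rewrite addr_gt0.
have pq_gt0 : 0 < p1 + p2 + q by rewrite addr_gt0.
have h0 j := hyp_term_ge0 j pq_gt0 p1_gt0 p_gt0 x0.
have p1p : p1 <= p1 + p2 by rewrite lerDl ltW.
have [cv lE] := nneseries_cvgn_lim h0 (hyp_term_summable pq_gt0 p1_gt0 p1p x0 x1).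
split=> //; rewrite /W_density EFinM lE -nneseriesZl; last first.
  by move=> j _; rewrite lee_fin.
apply: eq_eseriesr => j _; rewrite -EFinM; congr EFin.
rewrite [RHS]ratio_term_hyp// /hyp_x; congr (_ * hyp_term _ _ _ (_ * _) _).
by rewrite /r invf_div.
Qed.

(** The density is restricted to the positive half-line: the ratio is almost
    surely positive, and outside it the formula for [W_density] carries no
    meaning. *)
Lemma has_pdf_W : has_pdf P W (W_density \_ D).
Proof.
have mH j : measurable_fun D (fun w => (C * ratio_term p1 p2 q a r w j)%:E).
  by apply/measurable_EFinP; rewrite /ratio_term; prove_measurable.
have p1_gt0 : 0 < p1 by exact: (half_gt0 m1_gt0).
have p2_gt0 : 0 < p2 by exact: (half_gt0 m2_gt0).
have q_gt0 : 0 < q by exact: (half_gt0 nu_gt0).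
have H0 w j : 0 < w -> (0 <= (C * ratio_term p1 p2 q a r w j)%:E)%E.
  by move=> w0; rewrite lee_fin mulr_ge0// ratio_term_ge0.
split.
- exact: measurable_W.
- apply/measurable_restrict => //; rewrite setTI.
  suff : measurable_fun D (EFin \o W_density) by move=> /measurable_EFinP.
  apply: (eq_measurable_fun (fun w => \sum_(j <oo) (C * ratio_term p1 p2 q a r w j)%:E)%E).
    by move=> w; rewrite inE/= in_itv/= andbT => w0; have [_ ->] := W_density_series w0.
  apply: ge0_emeasurable_sum => // k w; rewrite /= in_itv/= andbT => w0 _.
  exact: H0.
- move=> w; apply: restrict_ge0 => {}w; rewrite /= in_itv/= andbT => w0.
  rewrite -lee_fin; have [_ ->] := W_density_series w0.
  by apply: nneseries_ge0 => j _ _; exact: H0.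
move=> A mA; rewrite law_ratio// [LHS]integral_mkcond [RHS]integral_mkcond.
apply: eq_integral => w _; rewrite !patchE.
case: ifPn => [wD|_]; last by case: ifP.
have w0 : 0 < w by move: wD; rewrite inE/= in_itv/= andbT.
case: ifPn => wA; last first.
  rewrite eseries0// => j _ _.
  by rewrite indicE (negbTE wA) mulr0 mul0r.
have [_ ->] := W_density_series w0.
by apply: eq_eseriesr => j _; rewrite indicE wA mulr1.
Qed.

End law_of_ratio.

Theorem theorem2 (R : realType) (d : measure_display) (T : measurableType d)
    (P : probability T R) (X1 X2 V : {RV P >-> R}) (m1 m2 nu : nat)
    (alpha1 alpha2 : R)
    (m1_gt0 : (0 < m1)%N) (m2_gt0 : (0 < m2)%N) (nu_gt0 : (0 < nu)%N)
    (X1_chi2 : chi_square P m1 X1) (X2_chi2 : chi_square P m2 X2)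
    (V_chi2 : chi_square P nu V)
    (indep : independent3 P X1 X2 V)
    (alpha2_gt0 : 0 < alpha2) (alpha21 : alpha2 < alpha1) :
  let m := (m1 + m2)%N in
  let W := fun omega : T =>
    ((alpha1 * X1 omega + alpha2 * X2 omega) / m%:R) / (V omega / nu%:R) in
  let a := nu%:R * alpha2 / m%:R in
  let t := fun w : R => w / (a + w) in
  let u1 := 1 - alpha2 / alpha1 in
  let A := (alpha1 / alpha2) `^ (- (m1%:R / 2)) in
  let B0 := a `^ (nu%:R / 2) *
    (Gamma ((nu%:R + m%:R) / 2) / (Gamma (m%:R / 2) * Gamma (nu%:R / 2))) in
  let B1 := fun w : R =>
    w `^ ((m%:R - 2) / 2) / (a + w) `^ ((nu%:R + m%:R) / 2) in
  let terms := fun (w : R) (j : nat) =>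
    pochhammer ((nu%:R + m1%:R + m2%:R) / 2) j * pochhammer (m1%:R / 2) j /
      (j`!%:R * pochhammer ((m1%:R + m2%:R) / 2) j) * (u1 * t w) ^+ j in
  exists hW : R -> R,
    [/\ has_pdf P W hW,
        (forall w, w <= 0 -> hW w = 0) &
        forall w, 0 < w ->
          [/\ cvgn (series (terms w)),
              hW w = A * B0 * B1 w * limn (series (terms w)) &
              hW w = A * B0 * B1 w *
                hyp2F1 ((nu%:R + m1%:R + m2%:R) / 2) (m1%:R / 2)
                  ((m1%:R + m2%:R) / 2)
                  ((1 - alpha2 / alpha1) * (w / (a + w)))]].
Proof.
move=> m W a t u1 A B0 B1 terms.
have m_gt0 : 0 < m%:R :> R by rewrite ltr0n addn_gt0 m1_gt0.
pose p1 : R := m1%:R / 2; pose p2 : R := m2%:R / 2; pose q : R := nu%:R / 2.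
exists (W_density m1 m2 nu alpha1 alpha2 m%:R \_ `]0, +oo[); split.
- exact: has_pdf_W.
- move=> w w0; rewrite patchE ifF//; apply/negbTE.
  by rewrite notin_setE/= in_itv/= andbT; apply/negP; rewrite -leNgt.
move=> w w0.
have wD : w \in (`]0, +oo[%classic : set R) by rewrite inE/= in_itv/= andbT.
have pE : p1 + p2 = m%:R / 2 by rewrite /p1 /p2 /m natrD mulrDl.
have pE' : p1 + p2 = (m1%:R + m2%:R) / 2 by rewrite mulrDl.
have pqE : p1 + p2 + q = (nu%:R + m%:R) / 2 by rewrite pE /q; ring.
have pqE' : p1 + p2 + q = (nu%:R + m1%:R + m2%:R) / 2 by rewrite /p1 /p2 /q; ring.
have p1E : p1 + p2 - 1 = (m%:R - 2) / 2 by rewrite pE; field.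
have termsE : terms w = hyp_term (p1 + p2 + q) p1 (p1 + p2) (u1 * t w).
  by rewrite pqE' pE'.
have [cv _] := W_density_series m1_gt0 m2_gt0 nu_gt0 alpha2_gt0 alpha21 m_gt0 w0.
have hE : (W_density m1 m2 nu alpha1 alpha2 m%:R \_ `]0, +oo[) w =
    A * B0 * B1 w * limn (series (terms w)).
  by rewrite patchE wD /W_density -/p1 -/p2 -/q termsE /A /B0 /B1 -pqE -pE -p1E.
split=> //; first by rewrite termsE.
rewrite hE /hyp2F1; congr *%R; congr (limn _); congr series; apply/funext => j.
by rewrite /terms (mulrC j`!%:R).
Qed.
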